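(* Let $p$ be a prime. Then $$\widetilde{OGF}(p,A,x) = \prod_{j\ge 0} \frac{1}{1-x^{p^j}},$$ $$OGF(p,A,x) = \prod_{j\ge0}\frac{1}{1-x^{p^j}} - \frac{1}{1-x} = \frac{1}{1-x}\Big(\prod_{j\ge 1}\frac{1}{1-x^{p^j}} - 1\Big).$$ Moreover, defining $$g(p,A,x,z) = \sum_{j=0}^\infty z^j\sum_{k=1}^\infty \frac{x^{kp^j}}{k},$$ one has $$g(p,A,x,1) = \sum_{j=0}^\infty\sum_{k=1}^\infty\frac{x^{kp^j}}{k} = \log \widetilde{OGF}(p,A,x)$$ and $$g(p,A,x^p,1) = g(p,A,x,1) + \log(1-x).$$
   Context: For a finite group $G$ and a prime $p$, $r(p,G)$ is the number of conjugacy classes of $G$ whose elements have order $p^d$ for some $d \ge 1$, and $\tilde r(p,G) = r(p,G)+1$ (so $d=0$ is also allowed). For the sequence of symmetric groups $S_n$, $n\ge 0$ (with $S_0$ and $S_1$ trivial), $OGF(p,A,x) = \sum_{n\ge0} r(p,S_n)x^n$ and $\widetilde{OGF}(p,A,x) = \sum_{n\ge0}\tilde r(p,S_n)x^n$. All identities are identities of formal power series (in $x$, with coefficients polynomial in $z$ for $g$), with $\log(1-x) = -\sum_{k\ge1}x^k/k$. *)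

(* Defs.v *)
From HB Require Import structures.
From mathcomp Require Import all_boot all_order all_algebra all_fingroup.
From mathcomp Require Import boolp classical_sets.

Set Implicit Arguments.
Unset Strict Implicit.
Unset Printing Implicit Defensive.

Import GRing.Theory.
Local Open Scope ring_scope.

(* [f n] is the coefficient of x^n in [f]. *)
Record fps (R : Type) := FPS { coefs :> nat -> R }.

Lemma fpsP (R : Type) (f g : fps R) : (forall n, f n = g n) -> f = g.
Proof. by case: f g => [f] [g] /= fg; congr FPS; exact/funext. Qed.

HB.instance Definition _ (R : Type) := gen_eqMixin (fps R).
HB.instance Definition _ (R : Type) := gen_choiceMixin (fps R).

Section ZmoduleStructure.
Variable R : zmodType.
Implicit Types f g h : fps R.

Definition fps_zero : fps R := FPS (fun=> 0).
Definition fps_opp f : fps R := FPS (fun n => - f n).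
Definition fps_add f g : fps R := FPS (fun n => f n + g n).

Fact fps_addA : associative fps_add.
Proof. by move=> f g h; apply: fpsP => n /=; rewrite addrA. Qed.
Fact fps_addC : commutative fps_add.
Proof. by move=> f g; apply: fpsP => n /=; rewrite addrC. Qed.
Fact fps_add0 : left_id fps_zero fps_add.
Proof. by move=> f; apply: fpsP => n /=; rewrite add0r. Qed.
Fact fps_addN : left_inverse fps_zero fps_opp fps_add.
Proof. by move=> f; apply: fpsP => n /=; rewrite addNr. Qed.

HB.instance Definition _ :=
  GRing.isZmodule.Build (fps R) fps_addA fps_addC fps_add0 fps_addN.

Lemma coefs0 n : (0 : fps R) n = 0. Proof. by []. Qed.
Lemma coefsN f n : (- f) n = - f n. Proof. by []. Qed.
Lemma coefsD f g n : (f + g) n = f n + g n. Proof. by []. Qed.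
Lemma coefsB f g n : (f - g) n = f n - g n. Proof. by []. Qed.
Lemma coefs_sum (I : Type) (r : seq I) (P : pred I) (F : I -> fps R) n :
  (\sum_(i <- r | P i) F i) n = \sum_(i <- r | P i) F i n.
Proof. exact: (big_morph (fun f : fps R => f n)). Qed.

End ZmoduleStructure.

Section RingStructure.
Variable R : comNzRingType.
Implicit Types f g h : fps R.

Definition fpsC (c : R) : fps R := FPS (fun n => if n == 0%N then c else 0).
Definition fps_mul f g : fps R := FPS (fun n => \sum_(i < n.+1) f i * g (n - i)%N).

Local Definition trunc N f : {poly R} := \poly_(i < N) f i.

Local Lemma coef_trunc N f n : (n < N)%N -> (trunc N f)`_n = f n.
Proof. by move=> nN; rewrite coef_poly nN. Qed.

Local Lemma mul_trunc N f g n : (n < N)%N ->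
  fps_mul f g n = (trunc N f * trunc N g)`_n.
Proof.
move=> nN; rewrite coefM; apply: eq_bigr => i _.
rewrite !coef_trunc //; first exact: leq_ltn_trans (leq_subr _ _) nN.
by apply: leq_trans nN; exact: ltn_ord.
Qed.

Fact fps_mulA : associative fps_mul.
Proof.
move=> f g h; apply: fpsP => n.
transitivity ((trunc n.+1 f * (trunc n.+1 g * trunc n.+1 h))`_n).
  rewrite coefM; apply: eq_bigr => i _; rewrite coef_trunc //.
  by rewrite -mul_trunc // ltnS leq_subr.
rewrite mulrA coefM; apply: eq_bigr => i _; rewrite -mul_trunc //.
by rewrite coef_trunc // ltnS leq_subr.
Qed.

Fact fps_mulC : commutative fps_mul.
Proof.
by move=> f g; apply: fpsP => n; rewrite !(@mul_trunc n.+1) // mulrC.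
Qed.

Fact fps_mul1 : left_id (fpsC 1) fps_mul.
Proof.
move=> f; apply: fpsP => n /=.
by rewrite big_ord_recl /= mul1r subn0 big1 ?addr0 // => i _; rewrite mul0r.
Qed.

Fact fps_mulDl : left_distributive fps_mul +%R.
Proof.
move=> f g h; apply: fpsP => n; rewrite coefsD /= -big_split /=.
by apply: eq_bigr => i _; rewrite mulrDl.
Qed.

Fact fps_1_neq0 : fpsC 1 != 0.
Proof.
by apply/eqP => /(congr1 (fun f : fps R => f 0%N)) /eqP; rewrite (negPf (oner_neq0 R)).
Qed.

HB.instance Definition _ := GRing.Zmodule_isComNzRing.Build (fps R)
  fps_mulA fps_mulC fps_mul1 fps_mulDl fps_1_neq0.

Lemma coefs1 n : (1 : fps R) n = (n == 0%N)%:R.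
Proof. by case: n. Qed.
Lemma coefsC c n : fpsC c n = if n == 0%N then c else 0.
Proof. by []. Qed.
Lemma coefsM f g n : (f * g) n = \sum_(i < n.+1) f i * g (n - i)%N.
Proof. by []. Qed.

Lemma coefsM0 f g : (f * g) 0%N = f 0%N * g 0%N.
Proof. by rewrite coefsM big_ord1. Qed.

Lemma coefsCM c f n : (fpsC c * f) n = c * f n.
Proof.
rewrite coefsM big_ord_recl /= subn0 big1 ?addr0 // => i _.
by rewrite mul0r.
Qed.

Lemma coefsX_small f : f 0%N = 0 -> forall k n, (n < k)%N -> (f ^+ k) n = 0.
Proof.
move=> f0; elim=> [|k IHk] n // nk.
rewrite exprS coefsM big_ord_recl f0 mul0r add0r big1 // => i _.
rewrite IHk ?mulr0 //= /bump /= add1n.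
have n_gt0 : (0 < n)%N by apply: leq_ltn_trans (ltn_ord i).
by rewrite (@leq_trans n) // ltn_subrL.
Qed.

Definition fpsX : fps R := FPS (fun n => (n == 1%N)%:R).

(* Convergence for the x-adic topology. *)
Definition fps_cvg (u : nat -> fps R) (f : fps R) : Prop :=
  forall n, exists N, forall m, (N <= m)%N -> u m n = f n.

(* 0 by convention when [u] does not converge. *)
Definition fps_lim (u : nat -> fps R) : fps R := xget 0 [set f | fps_cvg u f]%classic.

Lemma fps_cvg_unique u f g : fps_cvg u f -> fps_cvg u g -> f = g.
Proof.
move=> uf ug; apply: fpsP => n.
have [[N uN] [M uM]] := (uf n, ug n).
by rewrite -(uN (maxn N M)) ?leq_maxl // (uM (maxn N M)) ?leq_maxr.
Qed.

Lemma fps_cvg_lim u f : fps_cvg u f -> fps_lim u = f.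
Proof. by move=> uf; apply: xget_unique => // g ug; apply: fps_cvg_unique ug uf. Qed.

Definition fps_sum (m : nat) (F : nat -> fps R) : fps R :=
  fps_lim (fun N => \sum_(m <= i < N) F i).
Definition fps_prod (m : nat) (F : nat -> fps R) : fps R :=
  fps_lim (fun N => \prod_(m <= i < N) F i).

Lemma fps_stable_cvg (u : nat -> fps R) :
  (forall n, exists N, forall m, (N <= m)%N -> u m.+1 n = u m n) ->
  fps_cvg u (fps_lim u).
Proof.
move=> /choice[N uN].
suff uf : fps_cvg u (FPS (fun n => u (N n) n)) by rewrite (fps_cvg_lim uf).
move=> n; exists (N n) => m /= /subnKC <-.
by elim: (m - N n)%N => [|k IHk]; rewrite ?addn0 // addnS uN ?leq_addr.
Qed.

Lemma fps_sum_cvg m (F : nat -> fps R) :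
  (forall n, exists N, forall i, (N <= i)%N -> F i n = 0) ->
  fps_cvg (fun N => \sum_(m <= i < N) F i) (fps_sum m F).
Proof.
move=> F0; apply: fps_stable_cvg => n; have [N FN] := F0 n.
exists (maxn m N) => k; rewrite geq_max => /andP[mk Nk].
by rewrite big_nat_recr //= FN // addr0.
Qed.

Lemma fps_prod_cvg m (F : nat -> fps R) :
  (forall n, exists N, forall i, (N <= i)%N ->
     forall j, (j <= n)%N -> F i j = (j == 0%N)%:R) ->
  fps_cvg (fun N => \prod_(m <= i < N) F i) (fps_prod m F).
Proof.
move=> F1; apply: fps_stable_cvg => n; have [N FN] := F1 n.
exists (maxn m N) => k; rewrite geq_max => /andP[mk Nk].
rewrite big_nat_recr //= -[RHS]/((\prod_(m <= i < k) F i) n).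
rewrite -[in RHS](mulr1 (\prod_(m <= i < k) F i)) !coefsM.
by apply: eq_bigr => i _; rewrite FN ?leq_subr // coefs1.
Qed.

End RingStructure.

Section UnitRingStructure.
Variable R : comUnitRingType.
Implicit Types f g : fps R.

Definition fps_unit : {pred fps R} := fun f => f 0%N \is a GRing.unit.

(* For c = 1 / f(0), the inverse of f is c * \sum_k (1 - c f)^k, and only the
   terms with k <= n contribute to the coefficient of x^n. *)
Definition fps_inv f : fps R :=
  if f \in fps_unit then
    FPS (fun n => (fpsC (f 0%N)^-1 *
                   \sum_(k < n.+1) (1 - fpsC (f 0%N)^-1 * f) ^+ k) n)
  else f.

Fact fps_mulVf : {in fps_unit, left_inverse 1 fps_inv *%R}.
Proof.
move=> f fU; rewrite mulrC /fps_inv fU.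
set c := fpsC _; set u := 1 - c * f.
have u0 : u 0%N = 0.
  by rewrite /u coefsB /c coefsCM mulVr ?subrr //.
apply: fpsP => n; rewrite coefsM.
transitivity ((f * (c * \sum_(k < n.+1) u ^+ k)) n).
  rewrite coefsM; apply: eq_bigr => i _; congr (_ * _).
  rewrite -[LHS]/((c * \sum_(k < (n - i).+1) u ^+ k) (n - i)%N).
  rewrite !coefsCM; congr (_ * _); rewrite !coefs_sum.
  have le : ((n - i).+1 <= n.+1)%N by rewrite ltnS leq_subr.
  rewrite (big_ord_widen _ (fun k => (u ^+ k) (n - i)%N) le).
  rewrite big_mkcond /=; apply: eq_bigr => k _.
  by case: ltnP => // lek; rewrite coefsX_small.
have -> : f * (c * \sum_(k < n.+1) u ^+ k) = 1 - u ^+ n.+1.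
  rewrite mulrA (mulrC f) -{1}(subKr 1 (c * f)) -/u.
  by rewrite -opprB mulNr -subrX1 opprB.
by rewrite coefsB coefsX_small // subr0.
Qed.

Fact fps_unitPl f g : g * f = 1 -> fps_unit f.
Proof.
move=> gf1; apply/unitrPr; exists (g 0%N).
by rewrite mulrC -coefsM0 gf1.
Qed.

Fact fps_inv_out : {in [predC fps_unit], fps_inv =1 id}.
Proof. by move=> f; rewrite inE /= /fps_inv => /negPf ->. Qed.

HB.instance Definition _ := GRing.ComNzRing_hasMulInverse.Build (fps R)
  fps_mulVf fps_unitPl fps_inv_out.

Lemma fps_unitE f : (f \is a GRing.unit) = (f 0%N \is a GRing.unit).
Proof. by []. Qed.

End UnitRingStructure.

Arguments fpsX {R}.

Declare Scope fps_scope.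
Delimit Scope fps_scope with fps.

Notation "\sum_ ( m <= i '<oo' ) F" := (fps_sum m (fun i => F))
  (F at level 41,
   format "'[' \sum_ ( m  <=  i  <oo ) '/  '  F ']'") : fps_scope.
Notation "\prod_ ( m <= i '<oo' ) F" := (fps_prod m (fun i => F))
  (F at level 36,
   format "'[' \prod_ ( m  <=  i  <oo ) '/  '  F ']'") : fps_scope.

Local Open Scope fps_scope.

(* Substitution f(h); meaningful when h has zero constant term. *)
Definition fps_comp (R : comNzRingType) (f h : fps R) : fps R :=
  \sum_(0 <= k <oo) (fpsC (f k) * h ^+ k).

(* Meaningful when f has constant term 1. *)
Definition fps_log (R : comUnitRingType) (f : fps R) : fps R :=
  - \sum_(1 <= k <oo) ((1 - f) ^+ k / k%:R).

Definition map_fps (R S : Type) (phi : R -> S) (f : fps R) : fps S :=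
  FPS (fun n => phi (f n)).

Definition rcl (p : nat) (gT : finGroupType) (G : {group gT}) : nat :=
  #|[set C in classes G |
      `[< exists d : nat, (0 < d)%N /\ {in C, forall x, #[x]%g = (p ^ d)%N} >]]|.

Definition rcl_tilde (p : nat) (gT : finGroupType) (G : {group gT}) : nat :=
  (rcl p G).+1.

Definition OGF (p : nat) : fps rat := FPS (fun n => (rcl p [set: 'S_n]%G)%:R).

Definition OGF_tilde (p : nat) : fps rat := FPS (fun n => (rcl_tilde p [set: 'S_n]%G)%:R).

(* The indeterminate z is 'X : {poly rat}. *)
Definition gser (p : nat) : fps {poly rat} :=
  \sum_(0 <= j <oo) (fpsC 'X^j * \sum_(1 <= k <oo) (fpsX ^+ (k * p ^ j)%N / k%:R)).

(* The value of the series at z = c, as a power series in x. *)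
Definition eval_z (c : rat) (g : fps {poly rat}) : fps rat :=
  map_fps (horner_eval c) g.

(* Main.v *)
Require Import Defs.
From mathcomp Require Import all_boot all_order all_algebra all_fingroup.
From mathcomp Require Import cyclic pgroup boolp.

Set Implicit Arguments.
Unset Strict Implicit.
Unset Printing Implicit Defensive.

Import GRing.Theory Num.Theory.
Local Open Scope ring_scope.
Local Open Scope fps_scope.

(** A permutation is determined up to conjugacy by its cycle type, and its order
    is the least common multiple of its cycle lengths.  So the classes of [S_n]
    of [p]-power order, the identity included, correspond to the ways of writing
    [n = \sum_j e_j p^j], where [e_j] is the number of cycles of length [p^j]
    ([rcl_tilde_Sn]); such a sum has [e_j <= n] for all [j], and [e_j = 0] for
    [j > n], so that there are finitely many.  Expanding each
    [1 / (1 - x^(p^j))] as a geometric series counts the same solutions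
    ([coefs_prod_geom]).  This is the product formula [OGF_tilde_prod]; taking
    out the factor [j = 0], which is [1 / (1 - x)], gives the formulas for
    [OGF].

    The correspondence with cycle types has two halves.  If two permutations
    have equally many cycles of each length, match the cycles of one with those
    of the other and follow both cycles in step from chosen base points: this
    conjugates one into the other ([cycle_type_intertwine]).  Conversely, every
    cycle type occurs, for a disjoint union of cyclic shifts
    ([realise_cycle_type]).

    On the logarithmic side, [log] turns products into sums because, for [f] of
    constant term 1, [log f] is the only series [l] without constant term such
    that [x l' f = x f'] ([fps_log_unique]).  Applied to the partial products,
    this gives
    [log \prod_j 1 / (1 - x^(p^j)) = \sum_j \sum_(k >= 1) x^(k p^j) / k]
    ([log_series_prod]).  Replacing [x] by [x^p] turns the [j]-th summand of this
    series into the [j+1]-st, so that only the summand [j = 0], which is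
    [- log (1 - x)], is lost ([log_series_comp]).

    Infinite sums and products are handled one coefficient at a time: in all
    those used here the [i]-th term or factor affects only the coefficients of
    index at least [i], or greater than [i], so that each coefficient is that of
    a finite sum or product. *)

(** * Cycle types of permutations *)

Section CycleType.
Local Open Scope nat_scope.
Local Notation order := fingraph.order.

(** The length [order f x] of the cycle through [x] is the exact period of [x]
    under [f]. *)
Lemma cycle_length_dvdn (T : finType) (f : T -> T) (injf : injective f) x m :
  (order f x %| m) = (iter m f x == x).
Proof.
have iterM k : iter (k * order f x) f x = x.
  by elim: k => // k IHk; rewrite mulSn iterD IHk iter_order.
rewrite {2}(divn_eq m (order f x)) addnC iterD iterM /dvdn.
rewrite -[in LHS](@findex_iter _ f x (m %% order f x)) ?ltn_mod ?fingraph.order_gt0 //.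
by rewrite findex_eq0 eq_sym.
Qed.

Lemma order_intertwine (T U : finType) (f : T -> T) (g : U -> U) (phi : T -> U) :
    injective f -> injective g -> injective phi ->
    (forall x, phi (f x) = g (phi x)) ->
  forall x, order g (phi x) = order f x.
Proof.
move=> injf injg injphi comm x; apply/eqP.
have iterE m : iter m g (phi x) = phi (iter m f x).
  by elim: m => //= m ->; rewrite comm.
rewrite eqn_dvd !cycle_length_dvdn // iterE iter_order // eqxx /=.
by apply/eqP/injphi; rewrite -iterE iter_order.
Qed.

Lemma card_order_set_intertwine (T U : finType) (f : T -> T) (g : U -> U)
    (phi : T -> U) :
    injective f -> injective g -> bijective phi ->
    (forall x, phi (f x) = g (phi x)) ->
  forall d, #|order_set f d| = #|order_set g d|.
Proof.
move=> injf injg bijphi comm d; have injphi := bij_inj bijphi.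
rewrite -(card_image injphi); apply: eq_card => y.
have [psi phiK psiK] := bijphi; rewrite -[y]psiK mem_image // !inE.
by rewrite (order_intertwine injf injg).
Qed.

(** Passes between the number of cycles of length [d], [fcard f (order_set f d)],
    and the number of points lying on them, which is easier to compute. *)
Lemma fcard_order_setM (T : finType) (f : T -> T) (injf : injective f) d :
  fcard f (order_set f d) * d = #|order_set f d|.
Proof.
apply: fcard_order_set => // x _ /eqP <-; rewrite !inE /order.
by rewrite (eq_card (same_fconnect1 injf x)).
Qed.

Lemma fcard_order_set_card (T U : finType) (f : T -> T) (g : U -> U) d :
    injective f -> injective g -> #|order_set f d| = #|order_set g d| ->
  fcard f (order_set f d) = fcard g (order_set g d).
Proof.
case: d => [|d] injf injg eq_fg.
  have fcard0 (V : finType) (h : V -> V) : fcard h (order_set h 0) = 0.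
    by apply: eq_card0 => x; rewrite !inE eqn0Ngt fingraph.order_gt0 andbF.
  by rewrite !fcard0.
by apply/eqP; rewrite -(@eqn_pmul2r d.+1) // !fcard_order_setM ?eq_fg.
Qed.

(** Both [A] and [B] are cut into fibres of equal sizes, and the [i]-th point of
    a fibre of [a] is sent to the [i]-th point of the corresponding fibre of
    [b].  The point [y0] is the default value of [nth]. *)
Lemma fiber_matching (T U : finType) (A : {pred T}) (B : {pred U})
    (a : T -> nat) (b : U -> nat) (y0 : U) :
    (forall d, #|[pred x in A | a x == d]| = #|[pred y in B | b y == d]|) ->
  exists h : T -> U, {in A &, injective h} /\
    {in A, forall x, h x \in B /\ b (h x) = a x}.
Proof.
move=> eq_fib.
pose fibA d := enum [pred x in A | a x == d].
pose fibB d := enum [pred y in B | b y == d].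
have sizeE d : size (fibA d) = size (fibB d) by rewrite -!cardE eq_fib.
have idx x : x \in A -> index x (fibA (a x)) < size (fibB (a x)).
  by move=> Ax; rewrite -sizeE index_mem mem_enum !inE Ax eqxx.
pose h x := nth y0 (fibB (a x)) (index x (fibA (a x))).
have hP x : x \in A -> h x \in B /\ b (h x) = a x.
  move=> Ax; have := mem_nth y0 (idx x Ax).
  by rewrite mem_enum inE => /andP[? /eqP].
exists h; split=> // x x' Ax Ax' eq_h.
have eq_a : a x = a x' by rewrite -(hP x Ax).2 eq_h (hP x' Ax').2.
move/eqP: eq_h; rewrite /h -eq_a nth_uniq ?enum_uniq ?idx //; last first.
  by rewrite eq_a idx.
move/eqP=> eq_i; rewrite -[x](@nth_index _ x x (fibA (a x))).
  by rewrite eq_i nth_index // mem_enum !inE Ax' eq_a eqxx.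
by rewrite mem_enum !inE Ax eqxx.
Qed.

(** A point [x] is reached from the root of its cycle in [findex f (r x) x] steps;
    [phi x] is reached in as many steps from the root matched to [r x].  This
    commutes with the two maps because matched cycles have the same length, so
    that both close up at the same time. *)
Lemma cycle_type_intertwine (T U : finType) (f : T -> T) (g : U -> U) :
    injective f -> injective g ->
    (forall d, fcard f (order_set f d) = fcard g (order_set g d)) -> U ->
  exists2 phi : T -> U, injective phi & forall x, phi (f x) = g (phi x).
Proof.
move=> injf injg eq_type y0.
have [|h [injh hP]] := @fiber_matching T U (froots f) (froots g) (order f) (order g) y0.
  exact: eq_type.
pose r := froot f.
have rootr x : r x \in froots f by exact: (roots_root (fconnect_sym injf)).
have conr x : fconnect f (r x) x.
  by rewrite fconnect_sym //; exact: connect_root.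
pose phi x := iter (findex f (r x) x) g (h (r x)).
exists phi => [x x' eq_phi|x].
  have eq_r : r x = r x'.
    apply: injh => //; have [[rx _] [rx' _]] := (hP _ (rootr x), hP _ (rootr x')).
    move/eqP: rx => <-; move/eqP: rx' => <-; apply/eqP.
    rewrite root_connect; last exact: fconnect_sym.
    apply: (@connect_trans _ _ (phi x)); first exact: fconnect_iter.
    by rewrite eq_phi fconnect_sym //; exact: fconnect_iter.
  have ordh := (hP _ (rootr x)).2.
  have := congr1 (findex g (h (r x))) eq_phi.
  rewrite /phi -eq_r !findex_iter ?ordh ?findex_max //; last by rewrite eq_r.
  by move=> eq_i; rewrite -(iter_findex (conr x)) eq_i iter_findex // eq_r.
have rf : r (f x) = r x.
  by apply/esym/eqP; rewrite root_connect; [exact: fconnect1|exact: fconnect_sym].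
rewrite /phi rf -iterS; set i := findex f (r x) x.
have fx : f x = iter i.+1 f (r x) by rewrite iterS iter_findex.
(* Either the cycle closes up at [f x], or the index just increases by one. *)
have : i.+1 <= order f (r x) by apply: findex_max.
rewrite leq_eqVlt => /orP[/eqP i_max|i_small]; last by rewrite fx findex_iter.
rewrite fx i_max iter_order // findex0 -(hP _ (rootr x)).2.
by rewrite iter_order.
Qed.

Lemma perm_conjg_cycle_type (T : finType) (s t : {perm T}) :
  (t \in s ^: [set: {perm T}])%g
  <-> forall d, fcard s (order_set s d) = fcard t (order_set t d).
Proof.
split=> [/imsetP[u _ ->] d | eq_type].
  apply: fcard_order_set_card; try exact: perm_inj.
  apply: (@card_order_set_intertwine _ _ _ _ u); try exact: perm_inj.
    by exists (u^-1)%g; [exact: permK|exact: permKV].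
  by move=> x; rewrite permJ.
have [x0 _|T0] := pickP (@predT T); last first.
  by rewrite (_ : t = s) ?class_refl //; apply/permP => x; have := T0 x.
have [phi injphi comm] :=
  cycle_type_intertwine (@perm_inj _ s) (@perm_inj _ t) eq_type x0.
apply/imsetP; exists (perm injphi); rewrite ?inE //; apply/permP => y.
have [x ->] : exists x, y = perm injphi x.
  by exists ((perm injphi)^-1%g y); rewrite permKV.
by rewrite permJ !permE -comm.
Qed.

(** The witness is the disjoint union, over [j], of [e j] copies of the cyclic
    shift of ['I_(c j)], transported to ['I_n]. *)
Lemma realise_cycle_type (K n : nat) (e c : 'I_K -> nat) :
    (forall j, 0 < c j) -> \sum_j e j * c j = n ->
  exists s : 'S_n, forall d, #|order_set s d| = \sum_(j | c j == d) e j * c j.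
Proof.
move=> c_gt0 sum_n.
pose T : finType := {j : 'I_K & ('I_(e j) * 'I_(c j))%type}.
have cardT : #|T| = n.
  rewrite card_tagged -sum_n sumnE big_map big_enum.
  by apply: eq_bigr => j _; rewrite card_prod !card_ord.
pose f (x : T) : T :=
  Tagged (fun j => ('I_(e j) * 'I_(c j))%type) ((tagged x).1, ordS (tagged x).2).
have iterf m x : iter m f x = Tagged (fun j => ('I_(e j) * 'I_(c j))%type)
     ((tagged x).1, iter m (@ordS _) (tagged x).2).
  by elim: m => [|m /= ->] //=; case: x => j [].
have iterS m k (i : 'I_k) : iter m (@ordS _) i = (i + m) %% k :> nat.
  elim: m => [|m /= ->]; first by rewrite addn0 modn_small.
  by rewrite addnS -addn1 modnDml addn1.
have ordf x m : (iter m f x == x) = (c (tag x) %| m).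
  case: x => j [a b]; rewrite iterf /= -tag_eqE /tag_eq /= eqxx /= tagged_asE.
  rewrite xpair_eqE eqxx /= -val_eqE /= iterS -[X in _ == X](modn_small (ltn_ord b)).
  by rewrite -[X in _ == X %% _]addn0 eqn_modDl mod0n.
have injf : injective f.
  (* The product of all cycle lengths is a common period of [f], so that [f] has
     an iterate as inverse. *)
  pose M := (\prod_j c j).-1.
  apply: (can_inj (g := iter M f)) => x.
  rewrite -iterSr prednK; last by apply: prodn_gt0.
  by apply/eqP; rewrite ordf (bigD1 (tag x)) //= dvdn_mulr.
have orderf x : order f x = c (tag x).
  apply/eqP; rewrite eqn_dvd -ordf iter_order // eqxx andbC /=.
  by rewrite cycle_length_dvdn // ordf.
pose phi (x : T) : 'I_n := cast_ord cardT (enum_rank x).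
pose psi (i : 'I_n) : T := enum_val (cast_ord (esym cardT) i).
have phiK : cancel phi psi by move=> x; rewrite /psi cast_ordK enum_rankK.
have psiK : cancel psi phi by move=> i; rewrite /phi enum_valK cast_ordKV.
pose g (i : 'I_n) := phi (f (psi i)).
have injg : injective g.
  exact: inj_comp (inj_comp (can_inj phiK) injf) (can_inj psiK).
exists (perm injg) => d.
rewrite -(@card_order_set_intertwine T _ f _ phi) //; last 3 first.
- exact: perm_inj.
- by exists psi.
- by move=> x; rewrite permE /g phiK.
rewrite -sum1_card.
transitivity (\sum_(j | c j == d) \sum_(x : 'I_(e j) * 'I_(c j)) 1).
  by rewrite sig_big_dep; apply: eq_bigl => x; rewrite inE orderf andbT.
by apply: eq_bigr => j _; rewrite sum1_card card_prod !card_ord.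
Qed.

End CycleType.

(** * Conjugacy classes of p-power order in symmetric groups *)

Section ClassCount.
Local Open Scope nat_scope.
Local Notation order := fingraph.order.

(** Used to count conjugacy classes by counting the values of a complete
    invariant, without exhibiting a bijection. *)
Lemma card_imset_same_fibers (aT rT1 rT2 : finType) (f1 : aT -> rT1)
    (f2 : aT -> rT2) (A : {set aT}) :
    {in A &, forall x y, f1 x = f1 y <-> f2 x = f2 y} ->
  #|f1 @: A| = #|f2 @: A|.
Proof.
suff le (rT rT' : finType) (f : aT -> rT) (f' : aT -> rT') :
    {in A &, forall x y, f' x = f' y -> f x = f y} -> #|f @: A| <= #|f' @: A|.
  move=> eq_ker; apply/eqP; rewrite eqn_leq.
  by apply/andP; split; apply: le => x y Ax Ay; apply eq_ker.
move=> ker_le; have [->|[x0 Ax0]] := set_0Vmem A; first by rewrite !imset0 cards0.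
pose h y := f (odflt x0 [pick x in A | f' x == y]).
apply: leq_trans (leq_imset_card h _).
apply/subset_leq_card/subsetP => _ /imsetP[x Ax ->].
apply/imsetP; exists (f' x); first exact: imset_f.
rewrite /h; case: pickP => [y /andP[Ay /eqP eq_y]|/(_ x)]; last by rewrite Ax eqxx.
exact: ker_le.
Qed.

(** The extra class counted by [rcl_tilde] is that of the identity, the case
    [d = 0]. *)
Lemma rcl_tildeE p (gT : finGroupType) (G : {group gT}) : prime p ->
  rcl_tilde p G = #|[set (x ^: G)%g | x in [set x in G | (p.-elt x)%g]]|.
Proof.
move=> p_pr; rewrite /rcl_tilde /rcl; set A := (X in _ = #|pred_of_set X|).
have class1A : [set 1%g] \in A.
  by apply/imsetP; exists 1%g; rewrite ?inE ?group1 ?p_elt1 // class1G.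
rewrite (cardsD1 [set 1%g] A) class1A add1n; congr _.+1.
apply: eq_card => C; rewrite !inE; apply/andP/andP => [[] | [C_neq1]].
  case/imsetP=> s Gs -> /asboolP[d [d_gt0 ord]].
  have ord_s := ord s (class_refl _ _); split.
    apply/eqP => C1; have: s \in [set 1%g] by rewrite -C1 class_refl.
    rewrite inE => /eqP s1; have := ltn_expl d (prime_gt1 p_pr).
    by rewrite -ord_s s1 order1 ltnNge d_gt0.
  by apply/imsetP; exists s; rewrite // inE Gs /p_elt ord_s pnatX pnat_id.
case/imsetP=> s; rewrite inE => /andP[Gs /p_natP[d ord_s]] C_s.
split; first by rewrite C_s; exact: imset_f.
apply/asboolP; exists d; split=> [|x].
  rewrite lt0n; apply: contraNneq C_neq1 => d0.
  by rewrite C_s; move/eqP: ord_s; rewrite d0 order_eq1 => /eqP ->; rewrite class1G.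
by rewrite C_s => /imsetP[g _ ->]; rewrite orderJ.
Qed.

Lemma iter_perm (T : finType) (s : {perm T}) m x : iter m s x = (s ^+ m)%g x.
Proof. by rewrite permX. Qed.

(** Cycle lengths divide the order of [s]; conversely [s ^+ (p ^ n)] is trivial if
    they are all of the form [p ^ j] with [j <= n].  The bound on [j] comes from
    [j < p ^ j <= n]. *)
Lemma p_elt_perm_order p n (s : 'S_n) : prime p ->
  reflect (forall x, exists j : 'I_n.+1, order s x = p ^ j) (p.-elt s)%g.
Proof.
move=> p_pr; have p_gt1 := prime_gt1 p_pr; apply: (iffP idP) => [ps x|ord].
  have : order s x %| #[s]%g.
    by rewrite cycle_length_dvdn ?iter_perm ?expg_order ?perm1 //; exact: perm_inj.
  move/(pnat_dvd)/(_ ps)/p_natP => [j ord_j].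
  suff j_n : j < n.+1 by exists (Ordinal j_n).
  apply/ltnW/(leq_trans (ltn_expl j p_gt1)); rewrite -ord_j.
  by apply: leq_trans (max_card _) _; rewrite card_ord.
have : #[s]%g %| p ^ n.
  rewrite order_dvdn; apply/eqP/permP => x; rewrite perm1 -iter_perm.
  apply/eqP; rewrite -cycle_length_dvdn; last exact: perm_inj.
  by have [j ->] := ord x; rewrite dvdn_exp2l // -ltnS.
by move/pnat_dvd; apply; rewrite pnatX pnat_id.
Qed.

(** A permutation of ['I_n] has at most [n] cycles, so that [inord] keeps their
    number, and [p ^ j <= n] forces [j <= n]. *)
Definition ppower_cycles p n (s : 'S_n) : {ffun 'I_n.+1 -> 'I_n.+1} :=
  [ffun j : 'I_n.+1 => inord (fcard s (order_set s (p ^ j)))].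

Arguments ppower_cycles p {n} s.

Lemma ppower_cyclesE p n (s : 'S_n) j : 0 < p ->
  ppower_cycles p s j = fcard s (order_set s (p ^ j)) :> nat.
Proof.
move=> p_gt0; rewrite ffunE inordK // ltnS.
apply: leq_trans (leq_pmulr _ (_ : 0 < p ^ j)) _; first by rewrite expn_gt0 p_gt0.
rewrite fcard_order_setM; last exact: perm_inj.
by apply: leq_trans (max_card _) _; rewrite card_ord.
Qed.

Lemma fcard_non_ppower p n (s : 'S_n) d : prime p -> (p.-elt s)%g ->
  (forall j : 'I_n.+1, d != p ^ j) -> fcard s (order_set s d) = 0.
Proof.
move=> p_pr /(p_elt_perm_order _ p_pr) ord_s d_neq; apply: eq_card0 => x.
rewrite !inE; have [j ->] := ord_s x.
by rewrite eq_sym (negPf (d_neq j)) andbF.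
Qed.

(** Counting the points of ['I_n] by the length of their cycle gives [n] as the sum
    of the [e_j p^j] for a [p]-element.  Conversely, if a permutation realises
    [e], its cycles of length a power of [p] already contain [n] points, so that
    there are no others. *)
Lemma ppower_cycles_imset p n : prime p ->
  ppower_cycles p @: [set s : 'S_n in [set: 'S_n] | (p.-elt s)%g]
  = [set e : {ffun 'I_n.+1 -> 'I_n.+1} | \sum_j e j * p ^ j == n].
Proof.
move=> p_pr; have p_gt0 := prime_gt0 p_pr; apply/setP => e.
have sum_order (T : finType) (f : T -> T) :
    \sum_(j < n.+1) #|order_set f (p ^ j)|
    = #|[pred x | [exists j : 'I_n.+1, order f x == p ^ j]]|.
  under eq_bigr => j _ do rewrite -sum1_card.
  rewrite (exchange_big_dep predT) //= -sum1_card [RHS]big_mkcond /=.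
  apply: eq_bigr => x _; rewrite inE.
  case: ifPn => [/existsP[j /eqP ord_x]|/existsPn no_j].
    rewrite (big_pred1 j) // => k; rewrite !inE ord_x eqn_exp2l ?prime_gt1 //.
    by rewrite eq_sym.
  by rewrite big_pred0 // => j; apply/negbTE/no_j.
rewrite inE; apply/imsetP/eqP => [[s] | sum_e].
  rewrite !inE /= => ps ->.
  under eq_bigr => j _ do
    rewrite ppower_cyclesE // (fcard_order_setM (@perm_inj _ s)).
  rewrite sum_order -[RHS]card_ord; apply: eq_card => x; rewrite !inE.
  by apply/existsP; have [j ->] := p_elt_perm_order _ p_pr ps x; exists j.
have ppow_gt0 (j : 'I_n.+1) : 0 < p ^ j by rewrite expn_gt0 p_gt0.
have [s ord_s] := realise_cycle_type ppow_gt0 sum_e.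
have ord_j (j : 'I_n.+1) : #|order_set s (p ^ j)| = e j * p ^ j.
  rewrite ord_s (big_pred1 j) // => k.
  by rewrite eqn_exp2l ?prime_gt1.
exists s.
  rewrite !inE; apply/(p_elt_perm_order _ p_pr) => x.
  (* By counting, all [n] points lie on cycles of p-power length. *)
  have /subset_leqif_card/leqifP :
      [pred x | [exists j : 'I_n.+1, order s x == p ^ j]] \subset 'I_n.
    by apply/subsetP.
  rewrite -sum_order (eq_bigr _ (fun j _ => ord_j j)) sum_e card_ord.
  case: ifP => [/subsetP/(_ x)|_]; last by rewrite ltnn.
  by rewrite !inE => /(_ isT)/existsP[j /eqP]; exists j.
apply/ffunP => j; apply/val_inj/eqP; rewrite /= ppower_cyclesE //.
by rewrite -(@eqn_pmul2r (p ^ j)) // fcard_order_setM ?ord_j //; exact: perm_inj.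
Qed.

(** Up to conjugacy a [p]-element is determined by its cycles of [p]-power length,
    as it has no others. *)
Lemma rcl_tilde_Sn p n : prime p ->
  rcl_tilde p [set: 'S_n]%G
  = #|[set e : {ffun 'I_n.+1 -> 'I_n.+1} | \sum_j e j * p ^ j == n]|.
Proof.
move=> p_pr; have p_gt0 := prime_gt0 p_pr.
rewrite rcl_tildeE // -ppower_cycles_imset //.
apply: card_imset_same_fibers => s t; rewrite !inE /= => ps pt.
split=> [/class_eqP/perm_conjg_cycle_type eq_type|eq_cyc].
  apply/ffunP => j; apply: ord_inj.
  apply: etrans (ppower_cyclesE s j p_gt0) _.
  apply: etrans (esym (eq_type (p ^ j))) _.
  exact: esym (ppower_cyclesE t j p_gt0).
apply/class_eqP/perm_conjg_cycle_type => d.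
have [[j ->]|no_j] := pselect (exists j : 'I_n.+1, d = p ^ j).
  by rewrite -!(ppower_cyclesE _ _ p_gt0) eq_cyc.
have d_neq (j : 'I_n.+1) : d != p ^ j by apply/eqP => d_j; apply: no_j; exists j.
by rewrite (fcard_non_ppower p_pr ps d_neq) (fcard_non_ppower p_pr pt d_neq).
Qed.

End ClassCount.

(** * Coefficients of infinite sums, products and compositions *)

Section Truncation.
Variable R : comNzRingType.
Implicit Types f g : fps R.

(** Congruence modulo [x^(n+1)]. *)
Definition eq_upto n f g := forall i, (i <= n)%N -> f i = g i.

Lemma eq_uptoM n f f' g g' :
  eq_upto n f f' -> eq_upto n g g' -> eq_upto n (f * g) (f' * g').
Proof.
move=> eq_f eq_g i le_in; rewrite !coefsM; apply: eq_bigr => j _.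
by rewrite eq_f ?eq_g // (leq_trans _ le_in) ?leq_subr // -ltnS.
Qed.

Lemma eq_upto_prod n (I : Type) (r : seq I) (F G : I -> fps R) :
  (forall i, eq_upto n (F i) (G i)) ->
  eq_upto n (\prod_(i <- r) F i) (\prod_(i <- r) G i).
Proof.
move=> eq_FG; elim/big_rec2: _ => // i f g _; exact: eq_uptoM.
Qed.

Lemma eq_uptoX n k f g : eq_upto n f g -> eq_upto n (f ^+ k) (g ^+ k).
Proof. by move=> eq_fg; elim: k => // k IHk; rewrite !exprS; apply: eq_uptoM. Qed.

Lemma coefs_fpsX k n : (fpsX ^+ k : fps R) n = (n == k)%:R.
Proof.
elim: k n => [|k IHk] n; first by rewrite expr0 coefs1.
rewrite exprS coefsM; case: n => [|n]; first by rewrite big_ord1 /= mul0r.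
rewrite (bigD1 (inord 1)) //= inordK // mul1r subSS subn0 IHk eqSS big1 ?addr0 //.
by move=> i; rewrite -val_eqE /= inordK // => /negPf ->; rewrite mul0r.
Qed.

Lemma coefs0_1subX d : (0 < d)%N -> (1 - fpsX ^+ d : fps R) 0%N = 1.
Proof. by move=> d_gt0; rewrite coefsB coefs1 coefs_fpsX (ltn_eqF d_gt0) subr0. Qed.

Lemma coefs_fps_sum m (F : nat -> fps R) N n :
  (forall i n, (n < i)%N -> F i n = 0) -> (n < N)%N ->
  (\sum_(m <= i <oo) F i) n = \sum_(m <= i < N) F i n.
Proof.
move=> F0 n_N; have [|M /(_ (maxn M N) (leq_maxl _ _)) <-] := @fps_sum_cvg _ m F _ n.
  by move=> k; exists k.+1 => i; apply: F0.
rewrite coefs_sum.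
have [le_mN|/ltnW le_Nm] := leqP m N; last first.
  rewrite [RHS]big_geq // big_nat_cond big1 // => i /andP[/andP[m_i _] _].
  by rewrite F0 // (leq_trans n_N) // (leq_trans le_Nm).
rewrite (big_cat_nat le_mN (leq_maxr M N)) /= addrC big_nat_cond big1 ?add0r //.
by move=> i /andP[/andP[N_i _] _]; rewrite F0 // (leq_trans n_N).
Qed.

Lemma coefs_fps_prod m (F : nat -> fps R) N n :
  (forall i n, (n <= i)%N -> F i n = (n == 0%N)%:R) -> (m <= N)%N -> (n <= N)%N ->
  (\prod_(m <= i <oo) F i) n = (\prod_(m <= i < N) F i) n.
Proof.
move=> F1 m_N n_N.
have [|M /(_ (maxn M N) (leq_maxl _ _)) <-] := @fps_prod_cvg _ m F _ n.
  by move=> k; exists k => i k_i j j_k; rewrite F1 // (leq_trans j_k).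
rewrite (big_cat_nat m_N (leq_maxr M N)) /=.
have tail1 : eq_upto n (\prod_(N <= i < maxn M N) F i) 1.
  rewrite big_nat_cond; elim/big_rec: _ => // i f /andP[/andP[N_i _] _] f1.
  rewrite -[1]mulr1; apply: eq_uptoM => // j j_n.
  by rewrite coefs1 F1 // (leq_trans j_n) // (leq_trans n_N).
transitivity ((\prod_(m <= i < N) F i * 1) n); last by rewrite mulr1.
exact: (eq_uptoM (fun _ _ => erefl) tail1).
Qed.

(** Multiplication by the first factor is continuous for the [x]-adic topology. *)
Lemma fps_prod_recl (F : nat -> fps R) :
  (forall i n, (n <= i)%N -> F i n = (n == 0%N)%:R) ->
  \prod_(0 <= i <oo) F i = F 0%N * \prod_(1 <= i <oo) F i.
Proof.
move=> F1; apply: fpsP => n.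
rewrite (coefs_fps_prod F1 (leq0n n.+1)) // big_ltn //.
apply: (@eq_uptoM n) => // i i_n.
by rewrite (coefs_fps_prod F1 (_ : 1 <= n.+1)%N) // ltnW.
Qed.

Lemma coefs_comp_fpsX f d n : (0 < d)%N ->
  fps_comp f (fpsX ^+ d) n = if (d %| n)%N then f (n %/ d)%N else 0.
Proof.
move=> d_gt0; rewrite (@coefs_fps_sum _ _ n.+1) // => [|k i i_k]; last first.
  rewrite coefsCM -exprM coefs_fpsX ltn_eqF ?mulr0 //.
  by rewrite (leq_trans i_k) // leq_pmull.
under eq_bigr => k _ do rewrite coefsCM -exprM coefs_fpsX.
case: ifP => [d_n|d'n]; last first.
  rewrite big1 // => k _; case: eqP => [n_dk|_]; last by rewrite mulr0.
  by rewrite n_dk dvdn_mulr in d'n.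
rewrite big_mkord.
rewrite (bigD1 (inord (n %/ d))) //= inordK ?ltnS ?leq_div //.
rewrite mulnC divnK // eqxx mulr1 big1 ?addr0 // => k.
rewrite -val_eqE /= inordK ?ltnS ?leq_div // => k_neq.
case: eqP => [n_dk|_]; last by rewrite mulr0.
by have /esym/eqP := mulKn k d_gt0; rewrite -n_dk (negPf k_neq).
Qed.

End Truncation.

(** * Geometric series and their products *)

Section Units.
Variable R : comUnitRingType.
Implicit Types f g : fps R.

Lemma fpsCV (c : R) : (fpsC c)^-1 = fpsC c^-1.
Proof.
have [cU|c'U] := boolP (c \is a GRing.unit); last first.
  by rewrite !invr_out // fps_unitE.
apply: (can_inj (mulKr (_ : fpsC c \is a GRing.unit))); first by rewrite fps_unitE.
rewrite mulrV ?fps_unitE //; apply: fpsP => n.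
by rewrite coefsCM !coefsC; case: (n == 0%N); rewrite ?mulrV ?mulr0.
Qed.

Lemma fps_natE k : k%:R = fpsC k%:R :> fps R.
Proof.
apply: fpsP => n; rewrite coefsC; elim: k => [|k IHk]; first by case: eqP.
by rewrite !mulrSr coefsD IHk coefs1; case: (n == 0%N); rewrite ?addr0.
Qed.

Lemma coefs_div_nat f k n : (f / k%:R) n = f n / k%:R.
Proof. by rewrite fps_natE fpsCV mulrC coefsCM mulrC. Qed.

Lemma fps_invX0 f : f 0%N = 1 -> f^-1 0%N = 1.
Proof.
move=> f0; have := congr1 (fun g : fps R => g 0%N) (@mulrV _ f _).
by rewrite coefsM0 f0 mul1r coefs1 => -> //; rewrite fps_unitE f0 unitr1.
Qed.

(** With [q = x^d], the remainder of the truncated geometric series is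
    [q^(n+1) / (1 - q)], which is divisible by [x^(n+1)]. *)
Lemma eq_upto_geom n d : (0 < d)%N ->
  eq_upto n (1 - fpsX ^+ d)^-1 (\sum_(a < n.+1) fpsX ^+ (a * d) : fps R).
Proof.
move=> d_gt0 i i_n; set q := fpsX ^+ d.
have U : 1 - q \is a GRing.unit.
  by rewrite fps_unitE coefs0_1subX ?unitr1.
have -> : (1 - q)^-1 = \sum_(a < n.+1) fpsX ^+ (a * d) + q ^+ n.+1 / (1 - q).
  apply: (can_inj (mulKr U)); rewrite mulrV // mulrDr.
  rewrite (mulrC (q ^+ _)) mulrA mulrV // mul1r.
  under eq_bigr => a _ do rewrite mulnC exprM -/q.
  by rewrite -opprB mulNr -subrX1 opprB subrK.
rewrite coefsD coefsM [X in _ + X]big1 ?addr0 // => j _.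
rewrite -exprM coefs_fpsX ltn_eqF ?mul0r //.
by rewrite (leq_trans (ltn_ord j)) // (leq_trans (_ : i < n.+1)%N) // leq_pmull.
Qed.

Lemma coefs_inv1subX n : ((1 - fpsX)^-1 : fps R) n = 1.
Proof.
rewrite -[fpsX]expr1 (@eq_upto_geom n) // coefs_sum.
under eq_bigr => a _ do rewrite coefs_fpsX muln1.
rewrite (bigD1 ord_max) //= eqxx big1 ?addr0 // => a.
by rewrite -val_eqE /= eq_sym => /negPf ->.
Qed.

(** The convergence condition for the product of the [1 / (1 - x^(p^i))], from
    [i < p^i]. *)
Lemma geom_factor_small p i n : prime p -> (n <= i)%N ->
  ((1 - fpsX ^+ (p ^ i))^-1 : fps R) n = (n == 0%N)%:R.
Proof.
move=> p_pr n_i; have n_pi : (n < p ^ i)%N.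
  by rewrite (leq_ltn_trans n_i) // ltn_expl // prime_gt1.
rewrite (@eq_upto_geom n) ?(leq_ltn_trans _ n_pi) // coefs_sum big_ord_recl mul0n.
rewrite expr0 coefs1 big1 ?addr0 // => a _; rewrite coefs_fpsX ltn_eqF //.
by rewrite (leq_trans n_pi) // leq_pmull.
Qed.

(** Distributing the product over the truncated geometric series gives one
    monomial [x^(\sum_j e_j c_j)] for each choice of the exponents [e_j <= n]. *)
Lemma coefs_prod_geom K (c : 'I_K -> nat) n : (forall j, (0 < c j)%N) ->
  (\prod_j (1 - fpsX ^+ c j)^-1 : fps R) n
  = #|[set e : {ffun 'I_K -> 'I_n.+1} | (\sum_j e j * c j == n)%N]|%:R.
Proof.
move=> c_gt0.
rewrite (@eq_upto_prod _ n _ _ _ (fun j => \sum_(a < n.+1) fpsX ^+ (a * c j))) //;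
  last by move=> j; apply: eq_upto_geom.
rewrite bigA_distr_bigA coefs_sum -sum1_card natr_sum.
have coefE (e : {ffun 'I_K -> 'I_n.+1}) :
    (\prod_j fpsX ^+ (e j * c j) : fps R) n = (n == \sum_j e j * c j)%N%:R.
  by rewrite prodrXr coefs_fpsX.
rewrite (eq_bigr _ (fun e _ => coefE e)).
rewrite [RHS]big_mkcond /=; apply: eq_bigr => e _.
by rewrite inE eq_sym; case: eqP.
Qed.

End Units.

(** * The logarithm of a power series *)

Section Logarithm.
Variable F : numFieldType.
Implicit Types f g u : fps F.

(** The Euler operator [x d/dx]: like [d/dx] a derivation, but it preserves the
    index of each coefficient, so that the Leibniz rule holds term by term. *)
Definition euler f : fps F := FPS (fun n => f n *+ n).

Lemma coefs_euler f n : euler f n = f n *+ n. Proof. by []. Qed.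

Lemma eulerD : {morph euler : f g / f + g}.
Proof. by move=> f g; apply: fpsP => n; rewrite /= mulrnDl. Qed.

Lemma eulerN : {morph euler : f / - f}.
Proof. by move=> f; apply: fpsP => n; rewrite /= mulNrn. Qed.

Lemma euler1 : euler 1 = 0.
Proof.
apply: fpsP => n; rewrite coefs_euler coefs1.
by case: n => [|n]; rewrite ?mulr0n ?mul0rn.
Qed.

Lemma euler_sum (I : Type) (r : seq I) (P : pred I) (G : I -> fps F) :
  euler (\sum_(i <- r | P i) G i) = \sum_(i <- r | P i) euler (G i).
Proof.
apply: (big_morph euler eulerD); apply: fpsP => n.
by rewrite coefs_euler mul0rn.
Qed.

Lemma eulerM f g : euler (f * g) = euler f * g + f * euler g.
Proof.
apply: fpsP => n; rewrite coefsD coefs_euler !coefsM -big_split /= -sumrMnl.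
apply: eq_bigr => i _; rewrite mulrnAl mulrnAr -mulrnDr subnKC //.
by rewrite -ltnS.
Qed.

Lemma eulerX u k : euler (u ^+ k.+1) = (u ^+ k * euler u) *+ k.+1.
Proof.
elim: k => [|k IHk]; first by rewrite expr0 mul1r.
rewrite exprS eulerM IHk mulrnAr mulrA -exprS [in RHS]mulrS; congr (_ + _).
by rewrite mulrC.
Qed.

Lemma natr_fps_unit k : (0 < k)%N -> (k%:R : fps F) \is a GRing.unit.
Proof. by move=> k_gt0; rewrite fps_natE fps_unitE unitfE pnatr_eq0 -lt0n. Qed.

(** Characteristic zero makes [f n *+ n] determine [f n] as soon as [n > 0]. *)
Lemma euler_inj f g : euler f = euler g -> f 0%N = g 0%N -> f = g.
Proof.
move=> eq_fg eq0; apply: fpsP => -[//|n].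
apply: (@pmulrnI _ n.+1) => //.
exact: (congr1 (fun h : fps F => h n.+1) eq_fg).
Qed.

Lemma eq_upto_euler n f g : eq_upto n f g -> eq_upto n (euler f) (euler g).
Proof. by move=> eq_fg i i_n; rewrite !coefs_euler eq_fg. Qed.

Lemma eulerX_div u k : euler (u ^+ k.+1 / k.+1%:R) = u ^+ k * euler u.
Proof.
have -> : euler (u ^+ k.+1 / k.+1%:R) = euler (u ^+ k.+1) / k.+1%:R.
  by apply: fpsP => n; rewrite coefs_euler !coefs_div_nat mulrnAl.
by rewrite eulerX -mulr_natr mulrK ?natr_fps_unit.
Qed.

Lemma coefs_log f N n : f 0%N = 1 -> (n < N)%N ->
  fps_log f n = - \sum_(1 <= k < N) ((1 - f) ^+ k) n / k%:R.
Proof.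
move=> f0 n_N; rewrite coefsN (@coefs_fps_sum _ _ _ N) // => [|k i i_k].
  by congr (- _); apply: eq_bigr => k _; rewrite coefs_div_nat.
by rewrite coefs_div_nat coefsX_small ?mul0r // coefsB f0 subrr.
Qed.

Lemma fps_log_1subX d :
  fps_log (1 - fpsX ^+ d : fps F) = - \sum_(1 <= k <oo) (fpsX ^+ (k * d)%N / k%:R).
Proof.
congr (- fps_sum _ _); apply/funext => k.
by rewrite subKr mulnC exprM.
Qed.

Lemma fps_log0 f : f 0%N = 1 -> fps_log f 0%N = 0.
Proof. by move=> f0; rewrite (@coefs_log _ 1) // big_geq // oppr0. Qed.

Lemma eq_upto_log n f g : f 0%N = 1 -> eq_upto n f g -> eq_upto n (fps_log f) (fps_log g).
Proof.
move=> f0 eq_fg i i_n; have g0 : g 0%N = 1 by rewrite -eq_fg.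
have eqX k : ((1 - f) ^+ k) i = ((1 - g) ^+ k) i.
  by apply: (@eq_uptoX _ n) => // j j_n; rewrite !coefsB eq_fg.
apply: etrans (coefs_log f0 (ltnSn i)) (etrans _ (esym (coefs_log g0 (ltnSn i)))).
exact: congr1 (eq_bigr _ (fun k _ => congr1 (fun x => x / k%:R) (eqX k))).
Qed.

(** Writing [u = 1 - f], differentiating [- \sum_(k >= 1) u^k / k] gives
    [- (\sum_(k >= 0) u^k) (x u')], that is, [x f'] times a geometric series that
    is the inverse of [1 - u = f]. *)
Lemma euler_log f : f 0%N = 1 -> euler (fps_log f) * f = euler f.
Proof.
move=> f0; apply: fpsP => n; pose u := 1 - f.
have u0 : u 0%N = 0 by rewrite coefsB f0 subrr.
have eq_log : eq_upto n (fps_log f) (- \sum_(1 <= k < n.+2) (u ^+ k / k%:R)).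
  move=> i i_n; rewrite (@coefs_log _ n.+2) ?ltnS ?leqW // coefsN coefs_sum.
  by congr (- _); apply: eq_bigr => k _; rewrite coefs_div_nat.
rewrite (eq_uptoM (eq_upto_euler eq_log) (fun _ _ => erefl)) //.
have -> : euler (- \sum_(1 <= k < n.+2) (u ^+ k / k%:R)) * f = euler f * (1 - u ^+ n.+1).
  rewrite eulerN euler_sum big_add1 /= big_mkord.
  under eq_bigr => k _ do rewrite eulerX_div.
  have -> : euler f = - euler u by rewrite eulerD eulerN euler1 add0r opprK.
  have -> : 1 - u ^+ n.+1 = f * \sum_(k < n.+1) u ^+ k.
    by rewrite -[LHS]opprB subrX1 -mulNr opprB subKr.
  rewrite -mulr_suml !mulNr; congr (- _).
  by rewrite [LHS]mulrC [RHS]mulrCA [euler u * _]mulrC.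
transitivity ((euler f * 1) n); last by rewrite mulr1.
apply: (@eq_uptoM _ n) => // i i_n.
by rewrite coefsB coefsX_small ?subr0 ?ltnS.
Qed.

(** The characterization of [log f] from which its algebraic properties follow
    without looking at its coefficients. *)
Lemma fps_log_unique f (l : fps F) :
  f 0%N = 1 -> l 0%N = 0 -> euler l * f = euler f -> fps_log f = l.
Proof.
move=> f0 l0 eul; have fU : f \is a GRing.unit by rewrite fps_unitE f0 unitr1.
apply: euler_inj; last exact: etrans (fps_log0 f0) (esym l0).
apply: (mulIr fU); exact: etrans (euler_log f0) (esym eul).
Qed.

Lemma fps_logM f g : f 0%N = 1 -> g 0%N = 1 ->
  fps_log (f * g) = fps_log f + fps_log g.
Proof.
move=> f0 g0; move: (fps_log0 f0) (fps_log0 g0) (euler_log f0) (euler_log g0).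
move: (fps_log f) (fps_log g) => lf lg lf0 lg0 eulf eulg.
apply: fps_log_unique.
- by rewrite coefsM0 f0 g0 mulr1.
- by rewrite coefsD lf0 lg0 addr0.
by rewrite eulerD mulrDl eulerM mulrA eulf mulrCA eulg.
Qed.

Lemma fps_log1 : fps_log (1 : fps F) = 0.
Proof.
apply: (addrI (fps_log 1)); rewrite addr0 -fps_logM ?mulr1 // coefs1.
Qed.

Lemma fps_logV f : f 0%N = 1 -> fps_log f^-1 = - fps_log f.
Proof.
move=> f0; apply/eqP; rewrite eq_sym -subr_eq0 -opprD oppr_eq0.
by rewrite -fps_logM ?fps_invX0 // mulrV ?fps_log1 // fps_unitE f0 unitr1.
Qed.

Lemma fps_prod0 (I : Type) (r : seq I) (G : I -> fps F) :
  (forall i, G i 0%N = 1) -> (\prod_(i <- r) G i) 0%N = 1.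
Proof.
move=> G0; elim/big_rec: _ => [|i f _ f0]; first by rewrite coefs1.
by rewrite coefsM0 G0 f0 mulr1.
Qed.

Lemma fps_log_prod (I : Type) (r : seq I) (G : I -> fps F) :
  (forall i, G i 0%N = 1) ->
  fps_log (\prod_(i <- r) G i) = \sum_(i <- r) fps_log (G i).
Proof.
move=> G0; elim: r => [|i r IHr]; first by rewrite !big_nil fps_log1.
by rewrite !big_cons fps_logM ?IHr ?fps_prod0.
Qed.

End Logarithm.

(** * The generating functions of p-power classes *)

Section PrimePowers.
Variables (p : nat) (p_prime : prime p).

Lemma OGF_tilde_prod :
  OGF_tilde p = \prod_(0 <= j <oo) (1 - fpsX ^+ (p ^ j)%N)^-1.
Proof.
apply: fpsP => n; rewrite (@coefs_fps_prod _ _ _ n.+1) //; last first.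
  by move=> i m; apply: geom_factor_small.
rewrite big_mkord (@coefs_prod_geom _ _ (fun j : 'I_n.+1 => p ^ j)%N) -?rcl_tilde_Sn //.
by move=> j; rewrite expn_gt0 prime_gt0.
Qed.

Lemma coefs_log_layer (R : comUnitRingType) d N n : (0 < d)%N -> (n < N)%N ->
  (\sum_(1 <= k <oo) (fpsX ^+ (k * d)%N / k%:R) : fps R) n
  = \sum_(1 <= k < N) (n == k * d)%N%:R / k%:R.
Proof.
move=> d_gt0 n_N; rewrite (@coefs_fps_sum _ _ _ N) // => [|k i i_k].
  by apply: eq_bigr => k _; rewrite coefs_div_nat coefs_fpsX.
rewrite coefs_div_nat coefs_fpsX ltn_eqF ?mul0r //.
by rewrite (leq_trans i_k) // leq_pmulr.
Qed.

Lemma log_layer_small (R : comUnitRingType) j n : (n < j)%N ->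
  (\sum_(1 <= k <oo) (fpsX ^+ (k * p ^ j)%N / k%:R) : fps R) n = 0.
Proof.
move=> n_j; rewrite (@coefs_log_layer _ _ n.+1) ?expn_gt0 ?prime_gt0 //.
rewrite big_nat_cond big1 // => k /andP[/andP[k_gt0 _] _].
rewrite ltn_eqF ?mul0r // (leq_trans n_j) // (leq_trans _ (leq_pmull _ k_gt0)) //.
by rewrite ltnW // ltn_expl // prime_gt1.
Qed.

Lemma coefs_log_series (R : comUnitRingType) M N n : (n < M)%N -> (n < N)%N ->
  (\sum_(0 <= j <oo) \sum_(1 <= k <oo) (fpsX ^+ (k * p ^ j)%N / k%:R) : fps R) n
  = \sum_(0 <= j < M) \sum_(1 <= k < N) (n == k * p ^ j)%N%:R / k%:R.
Proof.
move=> n_M n_N; rewrite (@coefs_fps_sum _ _ _ M) // => [|j i]; last exact: log_layer_small.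
by apply: eq_bigr => j _; rewrite (@coefs_log_layer _ _ N) ?expn_gt0 ?prime_gt0.
Qed.

(** For the [n]-th coefficient both sides may be cut at [j <= n], and then the
    logarithm of a finite product is a finite sum. *)
Lemma log_series_prod (F : numFieldType) :
  \sum_(0 <= j <oo) \sum_(1 <= k <oo) (fpsX ^+ (k * p ^ j)%N / k%:R)
  = fps_log (\prod_(0 <= j <oo) (1 - fpsX ^+ (p ^ j)%N)^-1) :> fps F.
Proof.
have q0 j : (1 - fpsX ^+ (p ^ j)%N : fps F) 0%N = 1.
  by apply: coefs0_1subX; rewrite expn_gt0 prime_gt0.
apply: fpsP => n; rewrite (@coefs_fps_sum _ _ _ n.+1) // => [|j i]; last exact: log_layer_small.
rewrite -(@eq_upto_log _ n (\prod_(0 <= j < n.+1) (1 - fpsX ^+ (p ^ j)%N)^-1)) //.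
- rewrite fps_log_prod => [|j]; last exact: fps_invX0.
  rewrite coefs_sum; apply: eq_bigr => j _.
  by rewrite fps_logV // fps_log_1subX opprK.
- by apply: fps_prod0 => j; apply: fps_invX0.
move=> i i_n; rewrite (@coefs_fps_prod _ _ _ n.+1) // => [j m|].
  exact: geom_factor_small.
exact: leqW.
Qed.

Lemma eval_gser : eval_z 1 (gser p)
  = \sum_(0 <= j <oo) \sum_(1 <= k <oo) (fpsX ^+ (k * p ^ j)%N / k%:R).
Proof.
apply: fpsP => n; rewrite (@coefs_log_series _ n.+1 n.+1) //.
rewrite /eval_z /map_fps /= /gser (@coefs_fps_sum _ _ _ n.+1) // => [|j i i_j]; last first.
  by rewrite coefsCM log_layer_small // mulr0.
rewrite horner_evalE horner_sum; apply: eq_bigr => j _.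
rewrite coefsCM (@coefs_log_layer _ _ n.+1) ?expn_gt0 ?prime_gt0 //.
rewrite hornerM hornerXn expr1n mul1r horner_sum; apply: eq_bigr => k _.
by rewrite -!(rmorph_nat (@polyC rat)) -fmorphV hornerM !hornerC.
Qed.

(** The [n]-th coefficient of the left-hand side is that of index [n / p] in [g],
    or zero if [p] does not divide [n]; and [n = k p^(j+1)] is the same as
    [n / p = k p^j]. *)
Lemma log_series_comp (F : numFieldType) :
  let g : fps F := \sum_(0 <= j <oo) \sum_(1 <= k <oo) (fpsX ^+ (k * p ^ j)%N / k%:R) in
  fps_comp g (fpsX ^+ p) = g + fps_log (1 - fpsX).
Proof.
move=> g; apply: fpsP => n; have p_gt0 := prime_gt0 p_prime.
rewrite coefs_comp_fpsX // coefsD -[fpsX in RHS]expr1 fps_log_1subX coefsN.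
(* One more value of [j] is kept here, as [j = 0] cancels against the logarithm. *)
rewrite (@coefs_log_layer _ _ n.+1) // (@coefs_log_series _ n.+2 n.+1 n) //.
rewrite big_nat_recl //= expn0 [RHS]addrC addKr.
case: ifP => [p_n|p'n].
  rewrite (@coefs_log_series _ n.+1 n.+1) ?ltnS ?leq_div //.
  apply: eq_bigr => j _; apply: eq_bigr => k _.
  by rewrite -[in RHS](divnK p_n) expnSr mulnA eqn_pmul2r.
rewrite big1 // => j _; rewrite big1 // => k _.
case: eqP => [n_eq|_]; last by rewrite mul0r.
by rewrite n_eq expnS mulnCA dvdn_mulr in p'n.
Qed.

End PrimePowers.

Theorem lemma4p1 (p : nat) (p_prime : prime p) :
  [/\ OGF_tilde p = \prod_(0 <= j <oo) (1 - fpsX ^+ (p ^ j)%N)^-1,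
      OGF p = \prod_(0 <= j <oo) (1 - fpsX ^+ (p ^ j)%N)^-1 - (1 - fpsX)^-1
      /\ \prod_(0 <= j <oo) (1 - fpsX ^+ (p ^ j)%N)^-1 - (1 - fpsX)^-1
         = (1 - fpsX)^-1 *
           (\prod_(1 <= j <oo) (1 - fpsX ^+ (p ^ j)%N)^-1 - 1) :> fps rat,
      eval_z 1 (gser p)
      = \sum_(0 <= j <oo) \sum_(1 <= k <oo) (fpsX ^+ (k * p ^ j)%N / k%:R)
      /\ \sum_(0 <= j <oo) \sum_(1 <= k <oo) (fpsX ^+ (k * p ^ j)%N / k%:R)
         = fps_log (OGF_tilde p)
    & fps_comp (eval_z 1 (gser p)) (fpsX ^+ p)
      = eval_z 1 (gser p) + fps_log (1 - fpsX)].
Proof.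
split.
- exact: OGF_tilde_prod.
- split.
    rewrite -OGF_tilde_prod //; apply: fpsP => n.
    by rewrite coefsB coefs_inv1subX /= /rcl_tilde -natr1 addrK.
  rewrite fps_prod_recl => [|i n]; last exact: geom_factor_small.
  by rewrite expn0 expr1 mulrBr mulr1.
- by split; [exact: eval_gser | rewrite OGF_tilde_prod //; exact: log_series_prod].
by rewrite eval_gser //; exact: log_series_comp.
Qed.
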